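(* Let $w^*\in W$, $\theta^*\in\mathbb{R}$, and let $\ell\in\mathbb{R}$ with $\ell>\theta^*$. Consider the following problem (SEP-L): $$\Phi^\ell_F(w^* )=\max_{x,t}\ t$$ subject to $$t\le c^T\hat y+\sum_{i\in N}\min\{(\ell-c^T\hat y)^+,\,d_i\}\,\hat y_i x_i\quad\forall \hat y\in\hat Y,$$ $$\sum_{i\in N} g_i x_i\le B_I,\qquad x_i\le 1-w^*_i\ \ \forall i\in N,\qquad x\in\{0,1\}^n,\ t\in\mathbb{R}.$$ Let $(x^*,t^* )$ be an optimal solution to (SEP-L). If $\Phi^\ell_F(w^* )>\theta^*$, then $\Phi_F(w^* )>\theta^*$ and $x^*$ gives a fortification cut $\theta\ge\Phi_I(x^* )-\sum_{i\in N} d_i x^*_i w_i$ which is violated at $(w^*,\theta^* )$, i.e. $\theta^*<\Phi_I(x^* )-\sum_{i\in N} d_i x^*_i w^*_i$. Otherwise, i.e. if $\Phi^\ell_F(w^* )\le\theta^*$, $(w^*,\theta^* )$ is a feasible solution to the fortification game, i.e. $w^*\in W$ and $\theta^*\ge\Phi_F(w^* )$.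
   Context: For $\alpha\in\mathbb{R}$, $(\alpha)^+=\max\{\alpha,0\}$. Let $N$ be a finite set of assets, $n=|N|$. For each $i\in N$ let $f_i\ge 0$ be a fortification cost, $g_i\ge 0$ an interdiction cost, and $d_i\ge 0$ a depreciation; let $B_F\ge 0$ and $B_I\ge 0$ be the fortification and interdiction budgets. Let $c\in\mathbb{R}^n$ and let $Y\subseteq\{0,1\}^n$ be nonempty (the feasible set of the recourse problem); $\hat Y$ denotes the set of extreme points of the convex hull of $Y$. Define - $W=\{w\in\{0,1\}^n:\sum_{i\in N} f_i w_i\le B_F\}$ (feasible fortification strategies), - $X=\{x\in\{0,1\}^n:\sum_{i\in N} g_i x_i\le B_I\}$ (interdiction strategies), - $X(w)=\{x\in X: x_i\le 1-w_i\ \forall i\in N\}$ for $w\in W$, - $\Phi_I(x)=\min_{y\in Y}\{c^Ty+\sum_{i\in N} d_i x_i y_i\}$ for $x\in X$, - $\Phi_F(w)=\max_{x\in X(w)}\Phi_I(x)$ for $w\in W$. The fortification game is $z^*=\min_{w\in W}\Phi_F(w)$, equivalently $\min\{\theta: w\in W,\ \theta\in\mathbb{R},\ \theta\ge\Phi_F(w)\}$; its feasible solutions $(w,\theta)$ are understood in the latter form. *)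

(* Defs.v *)
From mathcomp Require Export all_boot all_order all_algebra.
From mathcomp Require Export all_classical reals convex.
Set Implicit Arguments.
Unset Strict Implicit.
Unset Printing Implicit Defensive.
Import Order.TTheory GRing.Theory Num.Theory.
Local Open Scope classical_set_scope.
Local Open Scope ring_scope.

(* Maximum and minimum are attained values: the greatest (resp. least) element
   of the set, with the junk value 0 when there is none. *)
Definition set_max (R : realType) (A : set R) : R :=
  xget 0 (A `&` ubound A).

Definition set_min (R : realType) (A : set R) : R :=
  xget 0 (A `&` lbound A).

Lemma set_maxE (R : realType) (A : set R) (m : R) :
  A m -> ubound A m -> set_max A = m.
Proof.
move=> Am ubm; apply: xget_subset1; first by split.
move=> x y [Ax ux] [Ay uy]; apply/eqP; rewrite eq_le.
by rewrite (uy _ Ax) (ux _ Ay).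
Qed.

Lemma set_minE (R : realType) (A : set R) (m : R) :
  A m -> lbound A m -> set_min A = m.
Proof.
move=> Am lbm; apply: xget_subset1; first by split.
move=> x y [Ax lx] [Ay ly]; apply/eqP; rewrite eq_le.
by rewrite (ly _ Ax) (lx _ Ay).
Qed.

Definition convex_hull (R : realType) (E : lmodType R) (A : set E) : set E :=
  smallest (@convex_set R E) A.

Definition extreme_points (R : realType) (E : lmodType R) (A : set E) : set E :=
  [set y | A y /\ forall (a b : E) (t : R), A a -> A b -> 0 < t < 1 ->
     y = t *: a + (1 - t) *: b -> a = y /\ b = y].

(* Vectors of R^n with n = #|N|, indexed directly by the finite set N. *)
Notation vec N R := {ffun N -> R}.

Definition dot (R : realType) (N : finType) (u v : vec N R) : R :=
  \sum_i u i * v i.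

Definition binary (R : realType) (N : finType) : set (vec N R) :=
  [set v | forall i, v i = 0 \/ v i = 1].

Section FortificationGame.
Context (R : realType) (N : finType).
Context (f g d c : vec N R) (BF BI : R) (Y : set (vec N R)).
Implicit Types (w x y : vec N R) (theta l t : R).

Definition fortifications : set (vec N R) :=
  [set w | binary w /\ dot f w <= BF].

Definition interdictions : set (vec N R) :=
  [set x | binary x /\ dot g x <= BI].

Definition interdictions_at w : set (vec N R) :=
  [set x | interdictions x /\ forall i, x i <= 1 - w i].

Definition Phi_I x : R :=
  set_min [set dot c y + \sum_i d i * x i * y i | y in Y].

Definition Phi_F w : R :=
  set_max [set Phi_I x | x in interdictions_at w].

Definition game_feasible w theta : Prop :=
  fortifications w /\ theta >= Phi_F w.

Definition cut_rhs x w : R := Phi_I x - \sum_i d i * x i * w i.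

(* Being a cut means validity: every feasible solution (w, theta) of the game
   satisfies theta >= cut_rhs x w. *)
Definition fortification_cut x : Prop :=
  interdictions x /\
  forall w theta, game_feasible w theta -> theta >= cut_rhs x w.

(* R^o gives the vectors of R^N their R-module structure *)
Definition Yhat : set (vec N R) :=
  extreme_points (convex_hull (Y : set {ffun N -> R^o})).

Definition sepl_feasible l w x t : Prop :=
  [/\ forall y, Yhat y ->
        t <= dot c y
             + \sum_i Num.min (Num.max (l - dot c y) 0) (d i) * y i * x i,
      dot g x <= BI,
      forall i, x i <= 1 - w i &
      binary x].

Definition sepl_optimal l w x t : Prop :=
  sepl_feasible l w x t /\
  forall x' t', sepl_feasible l w x' t' -> t' <= t.

Definition Phi_L l w : R :=
  set_max [set t | exists x, sepl_feasible l w x t].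

End FortificationGame.

(* Main.v *)
(* The points of Y are 0/1 vectors, hence vertices of the unit cube, so Yhat is
   exactly Y.  For fixed x, each right-hand side of (SEP-L) is at most the
   corresponding term of Phi_I x, so t* <= Phi_I x*; and x* vanishes wherever
   w* does not, so the cut at w* loses nothing.  Conversely, a truncated term
   is either unchanged or still at least l, so (x, min(l, Phi_I x)) is feasible
   for (SEP-L): since l > theta*, an interdiction strategy beating theta* in the
   game also beats it in (SEP-L). *)
From mathcomp Require Import ring lra interval_inference.
Require Import Defs.
Set Implicit Arguments.
Unset Strict Implicit.
Unset Printing Implicit Defensive.
Import Order.TTheory GRing.Theory Num.Theory.
Local Open Scope classical_set_scope.
Local Open Scope ring_scope.

Lemma finite_argmin (R : realType) (T : choiceType) (A : set T) (F : T -> R) :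
  finite_set A -> A !=set0 -> exists2 a, A a & forall b, A b -> F a <= F b.
Proof.
move=> /finite_seqP[s ->] [a0 a0s].
case: (arg_minP (fun u : seq_sub s => F (val u)) (i0 := SeqSub a0s) (P := predT)) => //.
move=> u _ minu; exists (val u); first exact: valP.
by move=> b bs; exact: (minu (SeqSub bs)).
Qed.

(** Finiteness and nonemptiness make the minimum attained, so the default value 0 of [set_min] never
    occurs and bounds can be checked pointwise. *)
Lemma le_set_min (R : realType) (T : choiceType) (A : set T) (F : T -> R) t :
  finite_set A -> A !=set0 ->
  t <= set_min [set F a | a in A] <-> forall a, A a -> t <= F a.
Proof.
move=> finA A0; have [a Aa mina] := finite_argmin F finA A0.
rewrite (set_minE (m := F a)); first last.
- by move=> _ [b Ab <-]; exact: mina.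
- by exists a.
split=> [ta b Ab|]; last exact.
exact: le_trans ta (mina _ Ab).
Qed.

Lemma set_max_le (R : realType) (T : choiceType) (A : set T) (F : T -> R) t :
  finite_set A -> A !=set0 ->
  set_max [set F a | a in A] <= t <-> forall a, A a -> F a <= t.
Proof.
move=> finA A0; have [a Aa maxa] := finite_argmin (fun a => - F a) finA A0.
have {}maxa b : A b -> F b <= F a by move=> /maxa; rewrite lerN2.
rewrite (set_maxE (m := F a)); first last.
- by move=> _ [b Ab <-]; exact: maxa.
- by exists a.
split=> [ta b Ab|]; last exact.
exact: le_trans (maxa _ Ab) ta.
Qed.

Lemma binary_finite (R : realType) (N : finType) : finite_set (@binary R N).
Proof.
apply: (@sub_finite_set _ _
  [set [ffun i => (b i)%:R] | b in [set: {ffun N -> bool}]]).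
  move=> v vb; exists [ffun i => v i == 1] => //.
  apply/ffunP => i; rewrite !ffunE.
  by case: (vb i) => ->; rewrite ?eqxx // eq_sym oner_eq0.
exact/finite_image/finite_finset.
Qed.

Lemma convE (R : realType) (N : finType) (k : {i01 R})
    (x y : convex_lmodType {ffun N -> R^o}) i :
  (conv k x y : {ffun N -> R^o}) i =
  k%:num * (x : {ffun N -> R^o}) i + (1 - k%:num) * (y : {ffun N -> R^o}) i.
Proof. by rewrite {1}/conv /= !ffunE. Qed.

Lemma convex_hull_convex (R : realType) (E : lmodType R) (A : set E) :
  convex_set (convex_hull A).
Proof.
move=> x y k /set_mem hx /set_mem hy; apply/mem_set => C [cC AC].
by apply/set_mem/cC; apply/mem_set; [exact: hx | exact: hy].
Qed.

(* Removing an extreme point from the hull leaves a convex set. *)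
Lemma extreme_hull_sub (R : realType) (E : lmodType R) (A : set E) :
  extreme_points (convex_hull A) `<=` A.
Proof.
move=> y [hy exty]; apply: contrapT => nAy.
suff sub : convex_hull A `<=` convex_hull A `\ y.
  by have [_ []] := sub y hy.
apply: smallest_sub; last first.
  move=> a Aa; split; first exact: sub_gen_smallest.
  by move=> ay; apply: nAy; rewrite -ay.
(* Only weights strictly between 0 and 1 need checking, which is what extremality of [y] asks for: a
   combination equal to [y] would force [a = y]. *)
apply/convex_setW => a b /set_mem[ha nay] /set_mem[hb nby] k k0 k1.
apply/mem_set; split.
  by apply: set_mem; apply: convex_hull_convex; apply/mem_set.
move=> yE; apply: nay.
have [//|->//] := exty a b k%:num ha hb _ (esym yE).
by rewrite k0 k1.
Qed.

Lemma convex_hull_cube (R : realType) (N : finType) (A : set {ffun N -> R}) :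
  A `<=` @binary R N ->
  convex_hull (A : set {ffun N -> R^o}) `<=`
    [set v | forall i, 0 <= v i <= 1].
Proof.
move=> Abin; apply: smallest_sub.
  move=> a b k /set_mem ha /set_mem hb; apply/mem_set => i /=.
  rewrite convE.
  have k0 : 0 <= k%:num by [].
  have k1 : k%:num <= 1 by [].
  have /andP[a0 a1] := ha i; have /andP[b0 b1] := hb i.
  by apply/andP; split; nra.
by move=> v /Abin vb i /=; case: (vb i) => ->; rewrite ?lexx ?ler01.
Qed.

(** The hull lies in the unit cube, and 0 and 1 are extreme in [0, 1]: coordinate by coordinate, a
    proper convex combination reaching one of them has both ends there. *)
Lemma binary_sub_Yhat (R : realType) (N : finType)
    (A : set {ffun N -> R}) :
  A `<=` @binary R N -> A `<=` Yhat A.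
Proof.
move=> Abin y Ay; split; first exact: sub_gen_smallest.
move=> a b t /(convex_hull_cube Abin) ha /(convex_hull_cube Abin) hb.
move=> /andP[t0 t1] yE.
suff ab i : a i = y i /\ b i = y i by split; apply/ffunP => i; case: (ab i).
have yi : y i = t * a i + (1 - t) * b i by rewrite {1}yE !ffunE.
have /andP[a0 a1] := ha i; have /andP[b0 b1] := hb i.
have := Abin _ Ay i.
rewrite yi; move: (a i) (b i) a0 a1 b0 b1 => {a b ha hb yE yi} a b a0 a1 b0 b1.
by case=> E; split; rewrite E; apply/eqP; rewrite eq_le; apply/andP; split; nra.
Qed.

Lemma YhatE (R : realType) (N : finType) (A : set {ffun N -> R}) :
  A `<=` @binary R N -> Yhat A = A.
Proof.
move=> Abin; apply/seteqP; split; last exact: binary_sub_Yhat.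
exact: (@extreme_hull_sub _ {ffun N -> R^o}).
Qed.

Section Game.
Context (R : realType) (N : finType) (f g d c : {ffun N -> R}) (BF BI : R).
Context (Y : set {ffun N -> R}).
Hypotheses (g_ge0 : forall i, 0 <= g i) (d_ge0 : forall i, 0 <= d i).
Hypotheses (BI_ge0 : 0 <= BI) (Y_binary : Y `<=` @binary R N).
Hypothesis (Y_nonempty : Y !=set0).
Implicit Types (w x y : {ffun N -> R}) (t l : R).

Lemma binary_ge0 x i : binary x -> 0 <= x i.
Proof. by move=> /(_ i)[] ->. Qed.

Lemma le_Phi_I t x :
  t <= Phi_I d c Y x <->
  forall y, Y y -> t <= dot c y + \sum_i d i * x i * y i.
Proof.
by apply: le_set_min => //; apply: sub_finite_set (@binary_finite R N).
Qed.

Lemma Phi_F_le t w : binary w ->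
  Phi_F g d c BI Y w <= t <->
  forall x, interdictions_at g BI w x -> Phi_I d c Y x <= t.
Proof.
move=> wb; apply: set_max_le.
  by apply: sub_finite_set (@binary_finite R N) => x [[]].
(* The empty attack is admissible against every [w], so [Phi_F] is a genuine maximum. *)
exists [ffun=> 0]; split; first split.
- by move=> i; left; rewrite ffunE.
- by rewrite /dot big1 // => i _; rewrite ffunE mulr0.
- by move=> i; rewrite ffunE; case: (wb i) => ->; rewrite ?subr0 ?subrr.
Qed.

(** Dropping the fortified assets from [x] gives an attack [x'] admissible against [w]. As
    [y i <= 1], this lowers the cost of each [y] by at most the sum of [d i * x i * w i], so
    [cut_rhs x w] is at most [Phi_I x'], hence at most [theta]. *)
Lemma interdiction_fortification_cut x :
  interdictions g BI x -> fortification_cut f g d c BF BI Y x.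
Proof.
move=> Xx; split=> // w theta [[wb _]] /(Phi_F_le _ wb) Phi_le.
have [xb xB] := Xx.
pose x' := [ffun i => x i * (1 - w i)].
have x'_le i : x' i <= x i.
  by rewrite ffunE; case: (wb i) (xb i) => -> [] ->; lra.
have x'_int : interdictions_at g BI w x'.
  split; first split.
  - move=> i; rewrite ffunE.
    by case: (wb i) (xb i) => -> [] ->; [left|right|left|left]; ring.
  - by apply: le_trans xB; apply: ler_sum => i _; rewrite ler_wpM2l.
  - by move=> i; rewrite ffunE; case: (wb i) (xb i) => -> [] ->; lra.
apply: le_trans (Phi_le _ x'_int); apply/le_Phi_I => y Yy.
have := iffLR (le_Phi_I _ x) (lexx _) y Yy.
rewrite /cut_rhs lerBlDr => /le_trans; apply.
rewrite -addrA lerD2l -big_split; apply: ler_sum => i _ /=.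
rewrite ffunE; have := d_ge0 i.
by case: (wb i) (xb i) (Y_binary Yy i) => -> [] -> [] ->; lra.
Qed.

Lemma cut_rhs_interdictions_at x w : binary w ->
  interdictions_at g BI w x -> cut_rhs d c Y x w = Phi_I d c Y x.
Proof.
move=> wb [[xb _] xw]; rewrite /cut_rhs big1 ?subr0 // => i _.
have := xw i; case: (wb i) (xb i) => -> [] ->; rewrite ?mulr0 ?mul0r //.
by rewrite subrr ler10.
Qed.

Lemma sepl_feasible_le_Phi_I l w x t :
  sepl_feasible g d c BI Y l w x t -> t <= Phi_I d c Y x.
Proof.
move=> [t_le _ _ xb]; apply/le_Phi_I => y Yy.
apply: le_trans (t_le y _) _; first by rewrite YhatE.
rewrite lerD2l; apply: ler_sum => i _.
rewrite -!mulrA [y i * _]mulrC ler_wpM2r ?ge_min ?lexx ?orbT //.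
by apply: mulr_ge0; apply: binary_ge0 => //; apply: Y_binary.
Qed.

Lemma min_Phi_I_sepl_feasible l w x :
  interdictions_at g BI w x ->
  sepl_feasible g d c BI Y l w x (Num.min l (Phi_I d c Y x)).
Proof.
move=> [[xb xB] xw]; split=> //; rewrite YhatE // => y Yy.
have yb := Y_binary Yy.
set a := fun i => Num.min (Num.max (l - dot c y) 0) (d i) * y i * x i.
have a_ge0 i : 0 <= a i.
  by rewrite /a !mulr_ge0 ?binary_ge0 // le_min d_ge0 le_max lexx orbT.
have suma_ge0 (P : pred N) : 0 <= \sum_(i | P i) a i by exact: sumr_ge0.
(* If the base cost already reaches [l], the nonnegative truncated terms cannot spoil the bound. *)
have [l_le|l_gt] := leP l (dot c y).
  by rewrite ge_min (le_trans l_le) // lerDl.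
have [/existsP[i /andP[]]|] :=
    boolP [exists i, (x i * y i != 0) && (l - dot c y < d i)].
  (* An attacked asset used by [y] is truncated to [l - dot c y]; this single term lifts the
     right-hand side to [l]. *)
  move=> xy0 di; rewrite ge_min -lerBlDl (bigD1 i) //=.
  rewrite (le_trans _ (_ : a i <= _)) ?lerDl //.
  rewrite /a (max_idPl _) ?subr_ge0 ?(ltW l_gt) // (min_idPl (ltW di)).
  by move: xy0; case: (xb i) (yb i) => -> [] ->; rewrite ?mulr0 ?mul0r ?eqxx ?mulr1.
(* Otherwise truncation changes no nonzero term, and the right-hand side is the full cost of [y], at
   least [Phi_I x]. *)
rewrite negb_exists => /forallP small.
rewrite ge_min (le_trans (iffLR (le_Phi_I _ x) (lexx _) y Yy)) ?orbT //.
rewrite lerD2l; apply: ler_sum => i _; rewrite /a.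
have := small i; rewrite negb_and negbK -leNgt => /orP[/eqP xy0|di].
  by rewrite -!mulrA [y i * _]mulrC xy0 !mulr0.
rewrite (max_idPl _) ?subr_ge0 ?(ltW l_gt) // (min_idPr di).
by rewrite mulrAC.
Qed.

End Game.

Theorem theorem4 (R : realType) (N : finType)
    (f g d c : {ffun N -> R}) (BF BI : R) (Y : set {ffun N -> R})
    (f_ge0 : forall i, 0 <= f i)
    (g_ge0 : forall i, 0 <= g i)
    (d_ge0 : forall i, 0 <= d i)
    (BF_ge0 : 0 <= BF) (BI_ge0 : 0 <= BI)
    (Y_binary : Y `<=` @binary R N) (Y_nonempty : Y !=set0)
    (ws : {ffun N -> R}) (thetas l : R)
    (ws_W : fortifications f BF ws) (l_gt : l > thetas)
    (xs : {ffun N -> R}) (ts : R)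
    (opt : sepl_optimal g d c BI Y l ws xs ts) :
  (Phi_L g d c BI Y l ws > thetas ->
     [/\ Phi_F g d c BI Y ws > thetas,
         fortification_cut f g d c BF BI Y xs &
         thetas < cut_rhs d c Y xs ws]) /\
  (Phi_L g d c BI Y l ws <= thetas ->
     game_feasible f g d c BF BI Y ws thetas).
Proof.
have [feas ts_max] := opt; have [_ xB xw xb] := feas.
have wb : binary ws by case: ws_W.
have xs_at : interdictions_at g BI ws xs by [].
have -> : Phi_L g d c BI Y l ws = ts.
  by apply: set_maxE => [|t [x]]; [exists xs | exact: ts_max].
split=> [ts_gt|ts_le].
  have Phi_gt : thetas < Phi_I d c Y xs.
    apply: lt_le_trans ts_gt _; exact: sepl_feasible_le_Phi_I feas.
  split.
  - rewrite ltNge; apply/negP => /(Phi_F_le _ _ _ _ BI_ge0 _ wb)/(_ _ xs_at).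
    by rewrite leNgt Phi_gt.
  - exact: interdiction_fortification_cut.
  - by rewrite (cut_rhs_interdictions_at _ _ _ wb xs_at).
split=> //; apply/(Phi_F_le _ _ _ _ BI_ge0 _ wb) => x x_at.
have := ts_max _ _ (min_Phi_I_sepl_feasible c d_ge0 Y_binary Y_nonempty l x_at).
(* The minimum of [l] and [Phi_I x] is at most [thetas]; since [l > thetas], the bound must come
   from [Phi_I x]. *)
by move=> /le_trans/(_ ts_le); rewrite ge_min leNgt l_gt.
Qed.
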